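(* Let $r,c,c'\ge 1$ be integers. The moduli space $\mathcal{N}(r,c,c')$ of stable framed representations of the enhanced ADHM quiver of numerical type $(r,c,c')$ has a perfect obstruction theory, i.e., for every $[X]\in\mathcal{N}(r,c,c')$ the deformation complex $\mathcal{C}(X)$ satisfies $$H^0(\mathcal{C}(X))=H^3(\mathcal{C}(X))=0.$$
   Context: A representation of the enhanced ADHM quiver of numerical type $(r,c,c')$ is a tuple $X=(W,V,V',A,B,I,J,A',B',F)$, where $W,V,V'$ are complex vector spaces of dimensions $r,c,c'$, and $A,B\in\mathrm{End}(V)$, $I\in\mathrm{Hom}(W,V)$, $J\in\mathrm{Hom}(V,W)$, $A',B'\in\mathrm{End}(V')$, $F\in\mathrm{Hom}(V',V)$ satisfy the enhanced ADHM equations $$[A,B]+IJ=0,\quad AF-FA'=0,\quad BF-FB'=0,\quad JF=0,\quad [A',B']=0.$$ The group $\mathrm{GL}(V)\times\mathrm{GL}(V')$ acts by $(h,h')\cdot(A,B,A',B',F,I,J)=(hAh^{-1},hBh^{-1},h'A'h'^{-1},h'B'h'^{-1},hFh'^{-1},hI,Jh^{-1})$. Stability: $X$ is called stable if (S.1) $F$ is injective; and (S.2) there is no subspace $0\subseteq S\subsetneq V$ with $A(S)\subseteq S$, $B(S)\subseteq S$ and $\mathrm{im}(I)\subseteq S$. (This is equivalent to GIT $\Theta$-stability for any parameter $\Theta=(\theta,\theta',\theta_\infty)$ with $c\theta+c'\theta'+r\theta_\infty=0$, $\theta'>0$ and $\theta+\theta'<0$.) The moduli space $\mathcal{N}(r,c,c')$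 is the GIT quotient, for such a stability parameter, of the space of representations of type $(r,c,c')$ (with $W$ fixed) by $\mathrm{GL}(V)\times\mathrm{GL}(V')$; its points are the orbits $[X]$ of stable representations. The deformation complex $\mathcal{C}(X)$ is the complex of vector spaces, placed in degrees $0,1,2,3$, $$C^0\xrightarrow{d_0}C^1\xrightarrow{d_1}C^2\xrightarrow{d_2}C^3,$$ with - $C^0=\mathrm{End}(V)\oplus\mathrm{End}(V')$, - $C^1=\mathrm{End}(V)^{\oplus2}\oplus\mathrm{Hom}(W,V)\oplus\mathrm{Hom}(V,W)\oplus\mathrm{End}(V')^{\oplus2}\oplus\mathrm{Hom}(V',V)$, - $C^2=\mathrm{End}(V)\oplus\mathrm{Hom}(V',V)^{\oplus2}\oplus\mathrm{Hom}(V',W)\oplus\mathrm{End}(V')$, - $C^3=\mathrm{Hom}(V',V)$, and differentials $$d_0(h,h')=\big([h,A],\,[h,B],\,hI,\,-Jh,\,[h',A'],\,[h',B'],\,hF-Fh'\big),$$ $$d_1(a,b,i,j,a',b',f)=\big([a,B]+[A,b]+Ij+iJ,\ Af+aF-Fa'-fA',\ Bf+bF-Fb'-fB',\ jF+Jf,\ [a',B']+[A',b']\big),$$ $$d_2(c_1,c_2,c_3,c_4,c_5)=c_1F+Bc_2-c_2B'-Ac_3+c_3A'-Ic_4-Fc_5.$$ *)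

(* Defs.v *)
From HB Require Import structures.
From mathcomp Require Import all_boot all_order all_algebra.
From mathcomp Require Import complex.
From mathcomp Require Import classical_sets reals.

Set Implicit Arguments.
Unset Strict Implicit.
Unset Printing Implicit Defensive.

Import GRing.Theory.
Local Open Scope ring_scope.

Lemma pair_ext (T U : Type) (x y : T * U) : x.1 = y.1 -> x.2 = y.2 -> x = y.
Proof. by case: x y => [? ?] [? ?] /= -> ->. Qed.

Lemma fstZD (K : fieldType) (U1 U2 : vectType K) k (x y : U1 * U2) :
  (k *: x + y).1 = k *: x.1 + y.1.
Proof. by []. Qed.

Lemma sndZD (K : fieldType) (U1 U2 : vectType K) k (x y : U1 * U2) :
  (k *: x + y).2 = k *: x.2 + y.2.
Proof. by []. Qed.

Record cochain_complex (K : fieldType) := CochainComplex {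
  cochain : nat -> vectType K;
  differential : forall n, 'Hom(cochain n, cochain n.+1);
  differentialK : forall n, (differential n.+1 \o differential n = 0)%VF
}.

Section Cohomology.
Variables (K : fieldType) (C : cochain_complex K).

Definition cocycles (n : nat) : {vspace cochain C n} := lker (differential C n).

Definition coboundaries (n : nat) : {vspace cochain C n} :=
  match n with
  | 0 => 0%VS
  | m.+1 => limg (differential C m)
  end.

(* The coboundaries seen inside the vector space of cocycles. *)
Definition cocycle_coboundaries (n : nat) : {vspace subvs_of (cocycles n)} :=
  (linfun (@vsval _ _ (cocycles n)) @^-1: coboundaries n)%VS.

Definition cohomology (n : nat) : zmodType :=
  Quotient.quot (pred_of_vspace (cocycle_coboundaries n)).

End Cohomology.

Section EnhancedADHM.
Variables (K : fieldType) (W V V' : vectType K).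

(* [\o] and [+] have the same precedence, hence the parentheses around
   compositions. *)
Definition bracket (U : vectType K) (f g : 'End(U)) : 'End(U) :=
  ((f \o g) - (g \o f))%VF.

Record adhm_data := AdhmData {
  mapA : 'End(V);
  mapB : 'End(V);
  mapI : 'Hom(W, V);
  mapJ : 'Hom(V, W);
  mapA' : 'End(V');
  mapB' : 'End(V');
  mapF : 'Hom(V', V)
}.

Definition adhm_equations (X : adhm_data) : Prop :=
  [/\ bracket (mapA X) (mapB X) + (mapI X \o mapJ X)%VF = 0,
      ((mapA X \o mapF X) - (mapF X \o mapA' X))%VF = 0,
      ((mapB X \o mapF X) - (mapF X \o mapB' X))%VF = 0,
      (mapJ X \o mapF X)%VF = 0
    & bracket (mapA' X) (mapB' X) = 0].

Record adhm_rep := AdhmRep {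
  rep_data :> adhm_data;
  rep_equations : adhm_equations rep_data
}.

Definition stable (X : adhm_rep) : Prop :=
  injective (mapF X) /\
  ~ exists S : {vspace V},
      [/\ S != fullv,
          (mapA X @: S <= S)%VS,
          (mapB X @: S <= S)%VS
        & (limg (mapI X) <= S)%VS].

(* [h^-1%VF] is the two-sided inverse of [h] when [h] is in [GL]. *)
Definition GL (U : vectType K) : set 'End(U) := [set h | lker h == 0%VS]%classic.

Definition adhm_act (h : 'End(V)) (h' : 'End(V')) (X : adhm_data) : adhm_data :=
  AdhmData
    (h \o mapA X \o h^-1)%VF
    (h \o mapB X \o h^-1)%VF
    (h \o mapI X)%VF
    (mapJ X \o h^-1)%VF
    (h' \o mapA' X \o h'^-1)%VF
    (h' \o mapB' X \o h'^-1)%VF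
    (h \o mapF X \o h'^-1)%VF.

Definition adhm_orbit (X : adhm_rep) : set adhm_rep :=
  [set Y : adhm_rep | exists h h',
     [/\ GL h, GL h' & rep_data Y = adhm_act h h' X]]%classic.

(* The set of points of the moduli space of type [(\dim W, \dim V, \dim V')]. *)
Definition adhm_moduli : set (set adhm_rep) :=
  [set O | exists2 X, stable X & O = adhm_orbit X]%classic.

(* The deformation complex, see [deformation_complex] below; tuples list the
   summands in the order (h, h'), (a, b, i, j, a', b', f) and
   (c1, c2, c3, c4, c5). *)
Definition def_C0 : Type := ('End(V) * 'End(V'))%type.

Definition def_C1 : Type :=
  ('End(V) * 'End(V) * 'Hom(W, V) * 'Hom(V, W) * 'End(V') * 'End(V')
   * 'Hom(V', V))%type.

Definition def_C2 : Type :=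
  ('End(V) * 'Hom(V', V) * 'Hom(V', V) * 'Hom(V', W) * 'End(V'))%type.

Definition def_C3 : Type := 'Hom(V', V).

HB.instance Definition _ := Vector.on def_C0.
HB.instance Definition _ := Vector.on def_C1.
HB.instance Definition _ := Vector.on def_C2.
HB.instance Definition _ := Vector.on def_C3.

Section Differentials.
Variable X : adhm_data.
Let A := mapA X.
Let B := mapB X.
Let I := mapI X.
Let J := mapJ X.
Let A' := mapA' X.
Let B' := mapB' X.
Let F := mapF X.

Definition def_d0_fun (x : def_C0) : def_C1 :=
  let: (h, h') := x in
  (bracket h A, bracket h B, (h \o I)%VF, (- (J \o h))%VF,
   bracket h' A', bracket h' B', ((h \o F) - (F \o h'))%VF).

Definition def_d1_fun (x : def_C1) : def_C2 :=
  let: (a, b, i, j, a', b', f) := x in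
  (bracket a B + bracket A b + (I \o j)%VF + (i \o J)%VF,
   ((A \o f) + (a \o F) - (F \o a') - (f \o A'))%VF,
   ((B \o f) + (b \o F) - (F \o b') - (f \o B'))%VF,
   ((j \o F) + (J \o f))%VF,
   bracket a' B' + bracket A' b').

Definition def_d2_fun (x : def_C2) : def_C3 :=
  let: (c1, c2, c3, c4, c5) := x in
  ((c1 \o F) + (B \o c2) - (c2 \o B') - (A \o c3) + (c3 \o A')
   - (I \o c4) - (F \o c5))%VF.

Ltac linear_componentwise :=
  repeat apply: pair_ext; rewrite /= ?fstZD ?sndZD /= /bracket
    ?(comp_lfunDl, comp_lfunDr) -?(comp_lfunZl, comp_lfunZr)
    ?opprD ?scalerDr ?scalerN;
  repeat (rewrite [RHS]addrACA; congr (_ + _)); try by [].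

Fact def_d0_is_linear : linear def_d0_fun.
Proof. by move=> k [h h'] [g g']; linear_componentwise. Qed.

Fact def_d1_is_linear : linear def_d1_fun.
Proof.
move=> k [[[[[[a b] i] j] a'] b'] f] [[[[[[a1 b1] i1] j1] a1'] b1'] f1].
linear_componentwise.
Qed.

Fact def_d2_is_linear : linear def_d2_fun.
Proof.
move=> k [[[[a b] i] j] a'] [[[[a1 b1] i1] j1] a1'].
linear_componentwise.
Qed.

HB.instance Definition _ := GRing.isLinear.Build K
  def_C0 def_C1 _ def_d0_fun def_d0_is_linear.
HB.instance Definition _ := GRing.isLinear.Build K
  def_C1 def_C2 _ def_d1_fun def_d1_is_linear.
HB.instance Definition _ := GRing.isLinear.Build K
  def_C2 def_C3 _ def_d2_fun def_d2_is_linear.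

Definition def_d0 : 'Hom(def_C0, def_C1) := linfun def_d0_fun.
Definition def_d1 : 'Hom(def_C1, def_C2) := linfun def_d1_fun.
Definition def_d2 : 'Hom(def_C2, def_C3) := linfun def_d2_fun.

End Differentials.

Ltac lfun_expand := rewrite /= /bracket
  ?(comp_lfunDl, comp_lfunDr, comp_lfunNl, comp_lfunNr, opprD, opprK)
  ?comp_lfunA.

(* Proves [e = 0] when the summands of [e] cancel pairwise. *)
Ltac zmod_cancel := rewrite -[LHS]addr0 ?(opprD, opprK) -?addrA;
  repeat match goal with
  | |- - ?x + _ = _ => rewrite !(addrCA _ x) (addKr, addNKr)
  | |- ?x + _ = _ => rewrite !(addrCA _ (- x)) addKr
  end; try by [].

Ltac zmod_eq :=
  apply/eqP; rewrite -subr_eq0; apply/eqP; lfun_expand; zmod_cancel.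

Fact def_d1d0 (X : adhm_rep) : (def_d1 X \o def_d0 X = 0)%VF.
Proof.
apply/lfunP => -[h h']; rewrite comp_lfunE !lfunE /=.
case: X => [[A B I J A' B' F] [/= e1 e2 e3 e4 e5]].
repeat apply: pair_ext.
- transitivity ((h \o (bracket A B + (I \o J))) -
    ((bracket A B + (I \o J)) \o h))%VF; first by zmod_eq.
  by rewrite e1 comp_lfun0l comp_lfun0r subrr.
- transitivity ((h \o ((A \o F) - (F \o A'))) -
    (((A \o F) - (F \o A')) \o h'))%VF; first by zmod_eq.
  by rewrite e2 comp_lfun0l comp_lfun0r subrr.
- transitivity ((h \o ((B \o F) - (F \o B'))) -
    (((B \o F) - (F \o B')) \o h'))%VF; first by zmod_eq.
  by rewrite e3 comp_lfun0l comp_lfun0r subrr.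
- transitivity (- ((J \o F) \o h'))%VF; first by zmod_eq.
  by rewrite e4 comp_lfun0l oppr0.
- transitivity ((h' \o bracket A' B') - (bracket A' B' \o h'))%VF.
    by zmod_eq.
  by rewrite e5 comp_lfun0l comp_lfun0r subrr.
Qed.

Fact def_d2d1 (X : adhm_rep) : (def_d2 X \o def_d1 X = 0)%VF.
Proof.
apply/lfunP => -[[[[[[a b] i] j] a'] b'] f]; rewrite comp_lfunE !lfunE /=.
case: X => [[A B I J A' B' F] [/= e1 e2 e3 e4 e5]].
transitivity ((a \o ((B \o F) - (F \o B'))) - (b \o ((A \o F) - (F \o A')))
  + (i \o (J \o F)) - ((bracket A B + (I \o J)) \o f) + (f \o bracket A' B')
  - (((B \o F) - (F \o B')) \o a') + (((A \o F) - (F \o A')) \o b'))%VF.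
  by zmod_eq.
by rewrite e1 e2 e3 e4 e5 !comp_lfun0l !comp_lfun0r oppr0 !addr0.
Qed.

Definition deformation_cochain (n : nat) : vectType K :=
  match n with
  | 0 => def_C0
  | 1 => def_C1
  | 2 => def_C2
  | 3 => def_C3
  | _ => 'rV[K]_0
  end.

Definition deformation_differential (X : adhm_data) (n : nat) :
    'Hom(deformation_cochain n, deformation_cochain n.+1) :=
  match n return 'Hom(deformation_cochain n, deformation_cochain n.+1) with
  | 0 => def_d0 X
  | 1 => def_d1 X
  | 2 => def_d2 X
  | _ => 0
  end.

Fact deformation_differentialK (X : adhm_rep) (n : nat) :
  (deformation_differential X n.+1 \o deformation_differential X n = 0)%VF.
Proof.
case: n => [|[|n]]; [exact: def_d1d0 | exact: def_d2d1 | exact: comp_lfun0l].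
Qed.

Definition deformation_complex (X : adhm_rep) : cochain_complex K :=
  CochainComplex (deformation_differentialK X).

End EnhancedADHM.

Arguments adhm_moduli {K} W V V'.

(* Main.v *)
From HB Require Import structures.
Require Import Defs.
From mathcomp Require Import all_boot all_order all_algebra.
From mathcomp Require Import complex.
From mathcomp Require Import classical_sets reals.

Set Implicit Arguments.
Unset Strict Implicit.
Unset Printing Implicit Defensive.

Import GRing.Theory.
Local Open Scope ring_scope.

(** The vanishing of H^0 and H^3 rests on the generation half of stability: a
    subspace of V stable under A and B and containing im I is all of V
    ([stable_generated]).

    In degree 0, let (h, h') be a cocycle. Since h commutes with A and B and
    kills im I, its kernel is such a subspace, so h = 0; then F h' = h F = 0
    and the injectivity of F gives h' = 0 ([def_d0_ker]).

    In degree 3 one has to show that the image D of d_2 is all of Hom(V', V).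
    For v in V and a linear form xi on V', write v (x) xi for the map
    x |-> xi(x) v of rank at most one. Let S, the core of D, be the subspace
    of those v such that v (x) xi lies in D for every xi. The summands
    B c_2 - c_2 B', A c_3 - c_3 A' and I c_4 of d_2 give respectively
      (B v) (x) xi = v (x) (xi B')  modulo D,
      (A v) (x) xi = v (x) (xi A')  modulo D,
      (I w) (x) xi = 0              modulo D,
    so S is stable under A and B and contains im I. Hence S = V, and D
    contains every v (x) xi; these span Hom(V', V) ([def_d2_img]). This is the
    usual duality argument, in which one shows that a map V -> V' orthogonal
    to D under the trace pairing vanishes, with S in the role of the kernel.

    A point of the moduli space is the orbit of some stable representation,
    which need not be X itself, so stability is carried along the group action
    ([stable_act]). *)

Lemma cohomology_eq0 (K : fieldType) (C : cochain_complex K) (n : nat) :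
  (cocycles C n <= coboundaries C n)%VS -> forall x : cohomology C n, x = 0.
Proof.
move=> exactn x; rewrite -[x]reprK -[0]reprK.
apply/eqP; rewrite -Quotient.idealrBE.
set z := (X in X \in _).
change (z \in cocycle_coboundaries C n).
(* Membership in the quotiented subspace is membership of the underlying
   vector in the coboundaries. *)
rewrite -memv_preim lfunE.
exact: (subvP exactn _ (subvsP z)).
Qed.

Section RankOne.
Variables (K : fieldType) (U V : vectType K).

(** The map k |-> k v, i.e. v viewed as an element of Hom(K, V), so that
    rank-one maps become composites of linear functions. *)
Definition scalar_multiples (v : V) : 'Hom(K^o, V) :=
  linfun (fun a : K^o => a *: v).

Lemma scalar_multiplesE v a : scalar_multiples v a = a *: v.
Proof.
have lin : linear (fun a : K^o => a *: v).
  by move=> k x y; rewrite scalerDl scalerA.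
pose H := GRing.isLinear.Build K K^o V _ _ lin.
pose f : {linear K^o -> V} := HB.pack (fun a : K^o => a *: v) H.
exact: (lfunE f a).
Qed.

(** The tensor v (x) xi. *)
Definition rank_one (xi : 'Hom(U, K^o)) (v : V) : 'Hom(U, V) :=
  (scalar_multiples v \o xi)%VF.

Lemma rank_oneE xi v u : rank_one xi v u = (xi u : K) *: v.
Proof. by rewrite comp_lfunE scalar_multiplesE. Qed.

Fact rank_one_is_linear xi : linear (rank_one xi).
Proof.
move=> k v w; apply/lfunP => u.
by rewrite add_lfunE scale_lfunE !rank_oneE scalerDr !scalerA mulrC.
Qed.

HB.instance Definition _ xi := GRing.isLinear.Build K V 'Hom(U, V) _
  (rank_one xi) (rank_one_is_linear xi).

Definition dual_coord (k : 'I_(\dim {:U})) : 'Hom(U, K^o) :=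
  linfun (coord (vbasis {:U}) k : U -> K^o).

Lemma dual_coordE k u : dual_coord k u = coord (vbasis {:U}) k u.
Proof. by rewrite lfunE. Qed.

(** Any f is the sum of the f(e_k) (x) e_k^*, for the basis e of U and its
    dual basis e^*. *)
Lemma rank_one_span (D : {vspace 'Hom(U, V)}) :
  (forall k v, rank_one (dual_coord k) v \in D) -> D = fullv.
Proof.
move=> rkD; apply/vspaceP => f; rewrite memvf.
have -> : f = \sum_(k < \dim {:U}) rank_one (dual_coord k) (f (vbasis {:U})`_k).
  apply/lfunP => u; rewrite sum_lfunE {1}(coord_vbasis (memvf u)) linear_sum.
  by apply: eq_bigr => k _; rewrite rank_oneE dual_coordE linearZ.
by apply: rpred_sum => k _; exact: rkD.
Qed.

Lemma rank_one_dual_coord (xi : 'Hom(U, K^o)) v :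
  rank_one xi v =
    \sum_(k < \dim {:U}) (xi (vbasis {:U})`_k : K) *: rank_one (dual_coord k) v.
Proof.
apply/lfunP => u; rewrite sum_lfunE rank_oneE {1}(coord_vbasis (memvf u)).
rewrite linear_sum scaler_suml; apply: eq_bigr => k _.
by rewrite scale_lfunE rank_oneE dual_coordE linearZ scalerA [in RHS]mulrC.
Qed.

(** As an intersection over the dual basis this is a subspace by construction;
    [rank_one_coreP] recovers the condition on all linear forms. *)
Definition rank_one_core (D : {vspace 'Hom(U, V)}) : {vspace V} :=
  (\bigcap_k (linfun (rank_one (dual_coord k)) @^-1: D))%VS.

Lemma rank_one_coreP (D : {vspace 'Hom(U, V)}) v :
  reflect (forall xi, rank_one xi v \in D) (v \in rank_one_core D).
Proof.
rewrite memvE; apply: (iffP subv_bigcapP) => [vD xi | vD k _].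
  rewrite rank_one_dual_coord; apply: rpred_sum => k _; apply: rpredZ.
  by have := vD k isT; rewrite -memvE -memv_preim lfunE.
by rewrite -memvE -memv_preim lfunE /= vD.
Qed.

Lemma rank_one_core_full (D : {vspace 'Hom(U, V)}) :
  rank_one_core D = fullv -> D = fullv.
Proof.
move=> coreT; apply: rank_one_span => k v.
by apply: (rank_one_coreP D v); rewrite coreT memvf.
Qed.

Lemma rank_one_comp (g : 'End(U)) xi v :
  (rank_one xi v \o g)%VF = rank_one (xi \o g)%VF v.
Proof. by rewrite /rank_one comp_lfunA. Qed.

End RankOne.

Lemma comp_rank_one (K : fieldType) (U V V2 : vectType K) (g : 'Hom(V, V2))
    (xi : 'Hom(U, K^o)) v :
  (g \o rank_one xi v)%VF = rank_one xi (g v).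
Proof. by apply/lfunP => u; rewrite comp_lfunE !rank_oneE linearZ. Qed.

Section Stability.
Variables (K : fieldType) (W V V' : vectType K).
Implicit Types X Y : adhm_rep W V V'.

Lemma stable_generated X (S : {vspace V}) : stable X ->
    (forall v, v \in S -> mapA X v \in S) ->
    (forall v, v \in S -> mapB X v \in S) ->
    (forall w, mapI X w \in S) ->
  S = fullv.
Proof.
move=> [_ noS] SA SB SI; apply/eqP/negPn/negP => properS.
apply: noS; exists S; split=> //; apply/subvP => _ /memv_imgP[v Sv ->].
- exact: SA.
- exact: SB.
- exact: SI.
Qed.

(** If S contradicts the stability of the transported representation, then its
    preimage under h contradicts that of the original one. *)
Lemma stable_act X Y h h' : GL h -> GL h' ->
  rep_data Y = adhm_act h h' X -> stable X -> stable Y.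
Proof.
rewrite /GL /= => h_inj h'_inj YE stX; have [F_inj _] := stX.
have hVK := lker0_lfunVK h_inj; have hK := lker0_lfunK h_inj.
have h'VK := lker0_lfunVK h'_inj.
split=> [|[S []]]; rewrite YE /=.
  move=> x y; rewrite !comp_lfunE => /(can_inj hK)/F_inj.
  exact: (can_inj h'VK).
move=> properS /subvP SA /subvP SB /subvP SI; case/negP: properS.
have preS : (h @^-1: S)%VS = fullv.
  apply: (stable_generated stX) => [v|v|w]; rewrite -!memv_preim.
  - by move=> /(memv_img (h \o mapA X \o h^-1)%VF)/SA; rewrite !comp_lfunE hK.
  - by move=> /(memv_img (h \o mapB X \o h^-1)%VF)/SB; rewrite !comp_lfunE hK.
  - by rewrite -comp_lfunE; apply: SI; rewrite memv_img ?memvf.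
apply/eqP/vspaceP => v; rewrite memvf -[v]hVK memv_preim preS.
exact: memvf.
Qed.

Lemma moduli_stable X : adhm_moduli W V V' (adhm_orbit X) -> stable X.
Proof.
move=> [X0 stX0 orbE].
(* Equality of orbits becomes usable through the point X of its own orbit. *)
have : adhm_orbit X X.
  exists \1%VF, \1%VF; rewrite /GL /=.
  have ker1 (U : vectType K) : lker (\1%VF : 'End(U)) == 0%VS.
    by apply/lker0P => x y; rewrite !id_lfunE.
  have inv1 (U : vectType K) : (\1^-1)%VF = \1%VF :> 'End(U).
    by rewrite -[LHS]comp_lfun1l (lker0_compfV (ker1 U)).
  split; rewrite ?ker1 //.
  case: X {orbE} => -[A B I J A' B' F] eqs; rewrite /adhm_act /=.
  by rewrite !inv1 !comp_lfun1l !comp_lfun1r.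
rewrite orbE => -[h [h' [hGL h'GL XE]]].
exact: (stable_act hGL h'GL XE stX0).
Qed.

(** A cocycle is an infinitesimal automorphism of X, and a stable
    representation has none: ker h would be a destabilizing subspace
    unless h = 0. *)
Lemma def_d0_ker X : stable X -> lker (def_d0 X) = 0%VS.
Proof.
move=> stX; have [F_inj _] := stX.
apply/eqP; rewrite -subv0; apply/subvP => -[h h'].
rewrite memv_ker memv0 lfunE /= => /eqP[].
rewrite /bracket => hA hB hI _ _ _ hF.
have h0 : h = 0.
  apply/lfunP => v; rewrite lfunE /=; apply/eqP; rewrite -memv_ker.
  suff -> : lker h = fullv by exact: memvf.
  apply: (stable_generated stX) => [u|u|w]; rewrite !memv_ker.
  - move/eqP=> hu; move/lfunP/(_ u): hA.
    by rewrite !lfun_simp hu linear0 subr0 => ->.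
  - move/eqP=> hu; move/lfunP/(_ u): hB.
    by rewrite !lfun_simp hu linear0 subr0 => ->.
  - by move/lfunP/(_ w): hI; rewrite !lfun_simp => ->.
suff h'0 : h' = 0 by rewrite h0 h'0.
apply/lfunP => v; apply: F_inj; move/lfunP/(_ v)/eqP: hF.
by rewrite h0 !lfun_simp sub0r oppr_eq0 linear0 => /eqP.
Qed.

(** The commutator-like components of d_2 make the core of its image stable
    under A and B, and the component through I puts im I in it. *)
Lemma def_d2_img X : stable X -> limg (def_d2 X) = fullv.
Proof.
move=> stX; set D := limg _.
have imgD c : def_d2_fun X c \in D.
  by rewrite -[def_d2_fun X c]lfunE memv_img ?memvf.
pose A := mapA X; pose B := mapB X; pose I := mapI X.
pose A' := mapA' X; pose B' := mapB' X.
have simp0 := (comp_lfun0l, comp_lfun0r, addr0, add0r, subr0).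
have DA (f : 'Hom(V', V)) : ((A \o f) - (f \o A'))%VF \in D.
  have := imgD (0, 0, - f, 0, 0).
  by rewrite /= !simp0 ?(comp_lfunNl, comp_lfunNr, opprK).
have DB (f : 'Hom(V', V)) : ((B \o f) - (f \o B'))%VF \in D.
  have := imgD (0, f, 0, 0, 0).
  by rewrite /= !simp0 ?(comp_lfunNl, comp_lfunNr, opprK).
have DI (g : 'Hom(V', W)) : (I \o g)%VF \in D.
  have := imgD (0, 0, 0, - g, 0).
  by rewrite /= !simp0 ?(comp_lfunNl, comp_lfunNr, opprK).
apply: rank_one_core_full; apply: (stable_generated stX) => [v|v|w].
(* (A v) (x) xi = (A c - c A') + v (x) (xi A') for c = v (x) xi. *)
- move/rank_one_coreP=> vD; apply/rank_one_coreP => xi.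
  rewrite -comp_rank_one -(subrK (rank_one xi v \o A')%VF (_ \o _)%VF).
  by rewrite rpredD // rank_one_comp.
- move/rank_one_coreP=> vD; apply/rank_one_coreP => xi.
  rewrite -comp_rank_one -(subrK (rank_one xi v \o B')%VF (_ \o _)%VF).
  by rewrite rpredD // rank_one_comp.
apply/rank_one_coreP => xi.
rewrite -comp_rank_one; exact: DI.
Qed.

End Stability.

Theorem theorem8 (R : realType) (r c c' : nat) (W V V' : vectType R[i])
    (r_ge1 : (1 <= r)%N) (c_ge1 : (1 <= c)%N) (c'_ge1 : (1 <= c')%N)
    (dimW : \dim {: W} = r) (dimV : \dim {: V} = c) (dimV' : \dim {: V'} = c') :
  forall X : adhm_rep W V V', adhm_moduli W V V' (adhm_orbit X) ->
    (forall x : cohomology (deformation_complex X) 0, x = 0) /\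
    (forall x : cohomology (deformation_complex X) 3, x = 0).
Proof.
move=> X /moduli_stable stX; split; apply: cohomology_eq0.
  by rewrite /cocycles /= def_d0_ker.
by rewrite /coboundaries /= def_d2_img ?subvf.
Qed.
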